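(* The map $h:S^2_{\mathbb{R}}\to S^2(\pi/2)$ defined by $$h(x_1,x_2,x_3)=\frac{\pi}{2}\begin{pmatrix} x_1 i & x_2+x_3 i\\ -x_2+x_3 i & -x_1 i\end{pmatrix}$$ is a quandle isomorphism, where $S^2_{\mathbb{R}}$ is the spherical quandle of Azcan-Fenn and $S^2(\pi/2)$ is the augmented quandle $(S^2(\pi/2),SU(2),\exp|_{S^2(\pi/2)})$.
   Context: A quandle is a set $X$ with a binary operation $\triangleright:X\times X\to X$ such that (Q1) $x\triangleright x=x$ for all $x$; (Q2) for every $y\in X$ the map $x\mapsto x\triangleright y$ is a bijection of $X$; (Q3) $(x\triangleright y)\triangleright z=(x\triangleright z)\triangleright(y\triangleright z)$ for all $x,y,z$. A quandle homomorphism is a map $f$ with $f(x\triangleright y)=f(x)\triangleright f(y)$; a quandle isomorphism is a bijective quandle homomorphism. Spherical quandle $S^2_{\mathbb{R}}$ (Azcan-Fenn): the unit sphere $S^2=\{\bm{x}=(x_1,x_2,x_3)\in\mathbb{R}^3 : \langle\bm{x},\bm{x}\rangle=1\}$, with $\langle-,-\rangle$ the Euclidean inner product, and operation $\bm{x}\triangleright\bm{y}=2\langle\bm{x},\bm{y}\rangle\bm{y}-\bm{x}$. The augmented quandle $(S^2(r),SU(2),\exp|_{S^2(r)})$: let $\mathfrak{su}(2)=\left\{\begin{pmatrix} ix & z\\ -\overline{z} & -ix\end{pmatrix} : x\in\mathbb{R},\ z\in\mathbb{C}\right\}$, and for $r\in\mathbb{R}\setminus\{0\}$ let $S^2(r)=\left\{\begin{pmatrix}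 ix & z\\ -\overline{z} & -ix\end{pmatrix}\in\mathfrak{su}(2) : x^2+z\overline{z}=r^2\right\}$. The group $SU(2)$ acts on $S^2(r)$ from the right by $X\cdot g=g^{-1}Xg$, and the quandle operation is $X\triangleright Y=X\cdot\exp(Y)=\exp(Y)^{-1}X\exp(Y)$, where $\exp:\mathfrak{su}(2)\to SU(2)$ is the (matrix) exponential map. *)

(* Defs.v *)
From mathcomp Require Import all_boot all_order all_algebra.
From mathcomp Require Import all_classical all_reals all_analysis.
From mathcomp Require Import complex.
Set Implicit Arguments.
Unset Strict Implicit.
Unset Printing Implicit Defensive.
Import Order.TTheory GRing.Theory Num.Theory numFieldNormedType.Exports.
Local Open Scope classical_set_scope.
Local Open Scope ring_scope.
Local Open Scope complex_scope.

(* A quandle is carried by a set [X] of an ambient type [T]; the values of the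
   operation [op] outside [X] are irrelevant. *)
Record is_quandle (T : Type) (X : set T) (op : T -> T -> T) : Prop := IsQuandle {
  quandle_closed : forall x y, X x -> X y -> X (op x y) ;
  quandle_idem : forall x, X x -> op x x = x ;
  quandle_bij : forall y, X y -> set_bij X X (fun x => op x y) ;
  quandle_distr : forall x y z, X x -> X y -> X z ->
    op (op x y) z = op (op x z) (op y z) }.

Record is_quandle_isomorphism (T U : Type) (X : set T) (opX : T -> T -> T)
    (Y : set U) (opY : U -> U -> U) (f : T -> U) : Prop := IsQuandleIsomorphism {
  quandle_iso_dom : is_quandle X opX ;
  quandle_iso_cod : is_quandle Y opY ;
  quandle_iso_bij : set_bij X Y f ;
  quandle_iso_hom : forall x y, X x -> X y -> f (opX x y) = opY (f x) (f y) }.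

Record is_unit_subgroup (A : unitRingType) (G : set A) : Prop := IsUnitSubgroup {
  unit_subgroup_unit : forall g, G g -> g \is a GRing.unit ;
  unit_subgroup1 : G 1 ;
  unit_subgroupM : forall g k, G g -> G k -> G (g * k) ;
  unit_subgroupV : forall g, G g -> G g^-1 }.

(* Augmented quandles in the sense of Joyce: [G] is a group acting on [X] from
   the right through [act], and [kappa : X -> G] is the augmentation map. *)
Record is_augmented_quandle (T : Type) (A : unitRingType) (X : set T) (G : set A)
    (act : T -> A -> T) (kappa : T -> A) : Prop := IsAugmentedQuandle {
  augmented_group : is_unit_subgroup G ;
  augmented_act_closed : forall x g, X x -> G g -> X (act x g) ;
  augmented_act1 : forall x, X x -> act x 1 = x ;
  augmented_actM : forall x g k, X x -> G g -> G k ->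
    act x (g * k) = act (act x g) k ;
  augmented_map : forall x, X x -> G (kappa x) ;
  augmented_equivariant : forall x g, X x -> G g ->
    kappa (act x g) = g^-1 * kappa x * g ;
  augmented_fix : forall x, X x -> act x (kappa x) = x }.

Definition augmented_op (T A : Type) (act : T -> A -> T) (kappa : T -> A)
    (x y : T) : T := act x (kappa y).

Definition dot (R : pzSemiRingType) (n : nat) (x y : 'rV[R]_n) : R :=
  \sum_(i < n) x 0 i * y 0 i.

Definition sphere2 (R : realType) : set 'rV[R]_3 := [set x | dot x x = 1].

Definition spherical_op (R : realType) (x y : 'rV[R]_3) : 'rV[R]_3 :=
  (2 * dot x y) *: y - x.

Definition mx2 (K : Type) (a b c d : K) : 'M[K]_2 :=
  \matrix_(i < 2, j < 2)
    if i == 0 then (if j == 0 then a else b) else (if j == 0 then c else d).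

(* [lim] is taken in the normed space of matrices over [K] (sup norm). *)
Definition expmx (K : numFieldType) (n : nat) (M : 'M[K]_n.+1) : 'M[K]_n.+1 :=
  lim (series (fun k : nat => (k`!%:R)^-1 *: M ^+ k) @ \oo).

Definition SU2 (R : realType) : set 'M[R[i]]_2 :=
  [set g | g \is unitarymx /\ \det g = 1].

Definition su2_mx (R : realType) (x : R) (z : R[i]) : 'M[R[i]]_2 :=
  mx2 ('i * x%:C) z (- z^*) (- ('i * x%:C)).

Definition su2_sphere (R : realType) (r : R) : set 'M[R[i]]_2 :=
  [set M | exists x z,
     M = su2_mx x z /\ x%:C ^+ 2 + z * z^* = r%:C ^+ 2].

Definition conj_act (R : realType) (X g : 'M[R[i]]_2) : 'M[R[i]]_2 :=
  g^-1 * X * g.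

Definition sphere_to_su2 (R : realType) (x : 'rV[R]_3) : 'M[R[i]]_2 :=
  let x1 := x 0 (inord 0) in
  let x2 := x 0 (inord 1) in
  let x3 := x 0 (inord 2) in
  (pi / 2)%:C *: mx2 (x1%:C * 'i)            (x2%:C + x3%:C * 'i)
                     (- x2%:C + x3%:C * 'i)  (- (x1%:C * 'i)).

(* Main.v *)
Require Import Defs.
From mathcomp Require Import all_boot all_order all_algebra.
From mathcomp Require Import all_classical all_reals all_analysis.
From mathcomp Require Import complex.
From mathcomp Require Import ring lra.
Import numFieldNormedType.Exports.
Local Open Scope ring_scope.
Set Implicit Arguments.
Unset Strict Implicit.
Unset Printing Implicit Defensive.
Import Order.TTheory GRing.Theory Num.Theory.
Local Open Scope classical_set_scope.
Local Open Scope complex_scope.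
Local Open Scope ring_scope.

(** A matrix [M] of the sphere of radius [r] in su(2) satisfies the quadratic
    equation [M * M = - r ^+ 2], so its exponential series splits into the
    cosine and the sine series of [r]:
    [expmx M = cos r + (sin r / r) M] ([expmx_sqr_scalar]). For [r = pi / 2]
    the first term vanishes, and the exponential is just the rescaling
    [M |-> (2 / pi) M] onto the unit sphere of pure quaternions
    ([expmx_su2_sphere]). It is therefore equivariant under conjugation and
    fixes each point of the sphere, which gives the augmented quandle, hence a
    quandle ([is_quandle_augmented]).

    Write [h] for [sphere_to_su2]. Then [h x = (pi / 2) H x], where [H x] is
    the pure quaternion with coordinates [x], and [expmx (h y) = H y].
    The Clifford relation [H x H y + H y H x = - 2 <x, y>]
    ([pure_quaternion_anticomm]) together with [H y H y = - 1] gives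
    [(H y)^-1 (H x) (H y) = 2 <x, y> H y - H x], that is, conjugation by the
    exponential of [h y] is the half-turn around [y]. *)

(** * The quandle of an augmented quandle *)

Lemma is_quandle_augmented (T : Type) (A : unitRingType) (X : set T) (G : set A)
    (act : T -> A -> T) (kappa : T -> A) :
  is_augmented_quandle X G act kappa -> is_quandle X (augmented_op act kappa).
Proof.
case=> [[Gu G1 GM GV] actX act1 actM kG keq kfix]; rewrite /augmented_op.
split=> [x y Xx Xy|x Xx|y Xy|x y z Xx Xy Xz].
- exact/actX/kG.
- exact: kfix.
- have Gy := kG _ Xy; have Uy := Gu _ Gy; split.
  + by move=> x Xx; apply: actX.
  + move=> x x1 /set_mem Xx /set_mem Xx1 E; have GVy := GV _ Gy.
    have: act (act x (kappa y)) (kappa y)^-1 =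
        act (act x1 (kappa y)) (kappa y)^-1.
      by rewrite [act x _]E.
    by rewrite -!actM // divrr // !act1.
  + move=> x Xx; exists (act x (kappa y)^-1); first exact/actX/GV.
    by rewrite -actM ?mulVr ?act1//; apply: GV.
- have Gy := kG _ Xy; have Gz := kG _ Xz; have Uz := Gu _ Gz.
  have GVz := GV _ Gz.
  have Gyz : G ((kappa z)^-1 * kappa y * kappa z).
    exact: (GM _ _ (GM _ _ GVz Gy) Gz).
  rewrite keq// -[LHS]actM// -[RHS]actM//.
  by rewrite !mulrA divrr// mul1r.
Qed.

(** * The spherical quandle *)

Section dot.
Variables (R : comPzRingType) (n : nat).
Implicit Types (x y z : 'rV[R]_n) (a : R).

Lemma dotC x y : dot x y = dot y x.
Proof. by apply: eq_bigr => i _; rewrite mulrC. Qed.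

Lemma dotBl x y z : dot (x - y) z = dot x z - dot y z.
Proof. by rewrite -sumrB; apply: eq_bigr => i _; rewrite !mxE mulrBl. Qed.

Lemma dotZl a x y : dot (a *: x) y = a * dot x y.
Proof. by rewrite mulr_sumr; apply: eq_bigr => i _; rewrite !mxE mulrA. Qed.

Lemma dotBr x y z : dot x (y - z) = dot x y - dot x z.
Proof. by rewrite dotC dotBl !(dotC x). Qed.

Lemma dotZr a x y : dot x (a *: y) = a * dot x y.
Proof. by rewrite dotC dotZl dotC. Qed.

End dot.

Section spherical_quandle.
Variable R : realType.
Implicit Types x y z : 'rV[R]_3.

Lemma spherical_op_isometry z x y : dot z z = 1 ->
  dot (spherical_op x z) (spherical_op y z) = dot x y.
Proof.
move=> zz; rewrite /spherical_op !(dotBl, dotBr, dotZl, dotZr) zz (dotC z y).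
by ring.
Qed.

Lemma spherical_opK z x : dot z z = 1 ->
  spherical_op (spherical_op x z) z = x.
Proof.
move=> zz; rewrite {1}/spherical_op.
have -> : dot (spherical_op x z) z = dot x z.
  by rewrite /spherical_op dotBl dotZl zz; ring.
by rewrite /spherical_op subKr.
Qed.

Lemma is_quandle_sphere2 : is_quandle (@sphere2 R) (@spherical_op R).
Proof.
split=> [x y|x xx|y yy|x y z xx yy zz]; rewrite /sphere2 /=.
- by move=> xx yy; rewrite spherical_op_isometry.
- by rewrite /spherical_op xx mulr1 scaler_nat mulr2n addrK.
- split=> [x xx|x x' _ _|x xx].
  + by rewrite /= spherical_op_isometry.
  + by move=> /(congr1 (fun t => spherical_op t y)); rewrite !spherical_opK.
  + exists (spherical_op x y); last exact: spherical_opK.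
    by rewrite /= spherical_op_isometry.
- rewrite [RHS]/spherical_op spherical_op_isometry// /spherical_op.
  rewrite dotBl dotZl mulrBr scalerBr scalerBl !scalerA !opprB.
  have -> : 2 * (2 * dot x y * dot y z) = 2 * dot x y * (2 * dot y z) by ring.
  rewrite -!addrA; congr (_ + _); rewrite addrCA [RHS]addrCA.
  by congr (_ + _); rewrite addrC.
Qed.

End spherical_quandle.
(** * The exponential of a matrix with a scalar square *)

Section exponential.
Variable R : realType.

(** The type ascriptions select the topology that [R[i]] has as a normed
    field. *)
Lemma cvg_real_complex (u : nat -> R) (l : R) :
  u @ \oo --> l ->
  ((fun n => (u n)%:C) : nat -> (R[i] : numFieldType)) @ \oo
    --> (l%:C : (R[i] : numFieldType)).
Proof.
move=> ul; apply/cvgrPdist_lt => e e0.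
(* A positive element of [R[i]] is a positive real. *)
have [Re0 eE] : 0 < complex.Re e /\ e = (complex.Re e)%:C.
  move: e e0 => [a b]; rewrite ltcE /= => /andP[/eqP b0 a0].
  by split=> //; rewrite b0.
rewrite eE; near=> n; rewrite -rmorphB normc_def /= expr0n addr0 sqrtr_sqr ltcR.
by near: n; move/cvgrPdist_lt : ul; apply.
Unshelve. all: by end_near. Qed.

Lemma sqr_scalar_powE (n : nat) (r : R) (M : 'M[R[i]]_n.+1) (k : nat) :
  M * M = (- r ^+ 2)%:C *: 1 ->
  M ^+ k.*2 = ((- 1) ^+ k * r ^+ k.*2)%:C *: 1.
Proof.
move=> MM; rewrite -muln2 mulnC exprM expr2 MM exprZn expr1n -rmorphXn /=.
by rewrite exprM -exprMn mulN1r.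
Qed.

(** Even powers of [M] are scalar and odd ones are multiples of [M], so each
    term of the exponential series is a cosine or a sine term. *)
Lemma exp_coeff_sqr_scalar (n : nat) (r : R) (M : 'M[R[i]]_n.+1) (k : nat) :
  r != 0 -> M * M = (- r ^+ 2)%:C *: 1 ->
  (k`!%:R)^-1 *: M ^+ k = (cos_coeff r k)%:C *: 1 + (sin_coeff r k / r)%:C *: M.
Proof.
move=> r0 MM; rewrite -[k]odd_double_half.
have n0 m : m`!%:R != 0 :> R by rewrite pnatr_eq0 -lt0n fact_gt0.
have natE m : (m%:R : R[i])^-1 = (m%:R^-1 : R)%:C.
  by rewrite fmorphV rmorph_nat.
case: (odd k) => /=; rewrite ?add1n ?add0n natE.
  rewrite cos_coeff_odd scale0r add0r exprS (sqr_scalar_powE _ MM) -scalerAr.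
  rewrite mulr1 scalerA -rmorphM /=; congr (_%:C *: _).
  rewrite /sin_coeff /= odd_double /= doubleK (exprS r).
  by field; rewrite r0 n0.
rewrite sin_coeff_even mul0r scale0r addr0 (sqr_scalar_powE _ MM) scalerA.
rewrite -rmorphM /=; congr (_%:C *: _).
rewrite /cos_coeff /= odd_double /= doubleK -exprnP.
by field; rewrite n0.
Qed.

Lemma expmx_sqr_scalar (n : nat) (r : R) (M : 'M[R[i]]_n.+1) : r != 0 ->
  M * M = (- r ^+ 2)%:C *: 1 ->
  expmx M = (cos r)%:C *: 1 + (sin r / r)%:C *: M.
Proof.
move=> r0 MM; apply: cvg_lim; first exact: norm_hausdorff.
have -> : series (fun k => (k`!%:R)^-1 *: M ^+ k) =
    (fun m => (series (cos_coeff r) m)%:C *: 1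
            + (series (sin_coeff r) m / r)%:C *: M).
  apply/funext => m; rewrite /series /= mulr_suml !rmorph_sum /= !scaler_suml.
  by rewrite -big_split /=; apply: eq_bigr => k _; apply: exp_coeff_sqr_scalar.
apply: cvgD.
  apply: cvgZr_tmp; apply: cvg_real_complex.
  rewrite cos.unlock; exact: is_cvg_series_cos_coeff.
apply: cvgZr_tmp; apply: cvg_real_complex; apply: cvgMr_tmp.
rewrite sin.unlock; exact: is_cvg_series_sin_coeff.
Qed.

End exponential.

(** * Entrywise calculus of 2 x 2 matrices *)

Section mx2.
Variable R : comNzRingType.
Implicit Types a b c d : R.

Lemma mx2_congr (K : Type) (a b c d a' b' c' d' : K) :
  a = a' -> b = b' -> c = c' -> d = d' -> mx2 a b c d = mx2 a' b' c' d'.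
Proof. by move=> -> -> -> ->. Qed.

Lemma mx2_eta (K : Type) (M : 'M[K]_2) :
  M = mx2 (M 0 0) (M 0 1) (M 1 0) (M 1 1).
Proof.
apply/matrixP => i j; rewrite mxE.
by case: i j => [[|[|//]] i2] [[|[|//]] j2] /=; congr (M _ _); apply: val_inj.
Qed.

Lemma mx2D a b c d a' b' c' d' :
  mx2 a b c d + mx2 a' b' c' d' = mx2 (a + a') (b + b') (c + c') (d + d').
Proof. by rewrite [LHS]mx2_eta !mxE. Qed.

Lemma mx2N a b c d : - mx2 a b c d = mx2 (- a) (- b) (- c) (- d).
Proof. by rewrite [LHS]mx2_eta !mxE. Qed.

Lemma mx2Z k a b c d : k *: mx2 a b c d = mx2 (k * a) (k * b) (k * c) (k * d).
Proof. by rewrite [LHS]mx2_eta !mxE. Qed.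

Lemma mx2_scalar a : a *: 1 = mx2 a 0 0 a.
Proof. by rewrite [LHS]mx2_eta !mxE /= mulr1 mulr0. Qed.

Lemma mx2M a b c d a' b' c' d' : mx2 a b c d * mx2 a' b' c' d' =
  mx2 (a * a' + b * c') (a * b' + b * d') (c * a' + d * c') (c * b' + d * d').
Proof. by rewrite [LHS]mx2_eta !mxE !big_ord_recl !big_ord0 !mxE /= !addr0. Qed.

Lemma mxtrace_mx2 a b c d : \tr (mx2 a b c d) = a + d.
Proof. by rewrite /mxtrace !big_ord_recl big_ord0 !mxE /= addr0. Qed.

Lemma det_mx2 a b c d : \det (mx2 a b c d) = a * d - b * c.
Proof.
rewrite (expand_det_row _ 0) !big_ord_recl big_ord0 /cofactor !det_mx11 !mxE /=.
by rewrite addr0 expr0 mul1r expr1 mulN1r mulrN.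
Qed.

End mx2.

(** * The sphere in su(2) and the action of SU(2) *)

Lemma pihalf_neq0 (R : realType) : pi / 2 != 0 :> R.
Proof. by rewrite gt_eqF// divr_gt0// pi_gt0. Qed.

Section su2.
Variable R : realType.
Implicit Types (x y r : R) (z w : R[i]) (M g : 'M[R[i]]_2).
Local Open Scope sesquilinear_scope.

Lemma su2_mxE x a b : su2_mx x (a +i* b) =
  mx2 (0 +i* x) (a +i* b) ((- a) +i* b) (0 +i* (- x)).
Proof.
have ixE : 'i * x%:C = 0 +i* x :> R[i].
  by rewrite -[LHS]/((0 +i* 1) * (x +i* 0)); simpc.
rewrite /su2_mx ixE; apply: mx2_congr => //.
  by rewrite -[LHS]/((- a) +i* (- - b)) opprK.
by rewrite -[LHS]/((- 0) +i* (- x)) oppr0.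
Qed.

Lemma su2_mx_anticomm x y z w :
  su2_mx x z * su2_mx y w + su2_mx y w * su2_mx x z =
  (- (2 * (x * y + complex.Re z * complex.Re w
                 + complex.Im z * complex.Im w)))%:C *: 1.
Proof.
case: z w => [a b] [c d]; rewrite !su2_mxE !mx2M mx2D mx2_scalar /=.
by apply: mx2_congr; simpc; rewrite ?complexr0; congr Complex; ring.
Qed.

Lemma adjmx_su2 x z : (su2_mx x z) ^t* = - su2_mx x z.
Proof.
case: z => a b; rewrite su2_mxE mx2N [LHS]mx2_eta !mxE /=.
by apply: mx2_congr; rewrite -[Num.conj _]/(conjc _) /= -[RHS]/(Complex _ _);
  congr Complex; rewrite ?oppr0 ?opprK.
Qed.

Lemma su2_sphereP r M : su2_sphere r M <->
  exists x a b, M = su2_mx x (a +i* b) /\ x ^+ 2 + a ^+ 2 + b ^+ 2 = r ^+ 2.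
Proof.
have normE x a b : x%:C ^+ 2 + (a +i* b) * (a +i* b)^* =
    (x ^+ 2 + a ^+ 2 + b ^+ 2)%:C.
  rewrite -[Num.conj _]/(conjc _) /= -rmorphXn /= -addrA.
  by simpc; congr Complex; ring.
split=> [[x [[a b] [-> E]]]|[x [a [b [-> E]]]]].
  exists x, a, b; split=> //.
  by move: E; rewrite normE -rmorphXn => /complexI.
by exists x, (a +i* b); split=> //; rewrite normE E rmorphXn.
Qed.

Lemma su2_sphere_sqr r M : su2_sphere r M -> M * M = (- r ^+ 2)%:C *: 1.
Proof.
move=> /su2_sphereP[x [a [b [-> <-]]]]; rewrite su2_mxE mx2M mx2_scalar /=.
by apply: mx2_congr; simpc; rewrite ?complexr0; congr Complex; ring.
Qed.

Lemma su2_sphere_adj r M : su2_sphere r M -> M ^t* = - M.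
Proof. by move=> /su2_sphereP[x [a [b [-> _]]]]; exact: adjmx_su2. Qed.

Lemma su2_sphere_tr r M : su2_sphere r M -> \tr M = 0.
Proof.
by move=> /su2_sphereP[x [a [b [-> _]]]]; rewrite mxtrace_mx2 subrr.
Qed.

Lemma su2_sphere_det r M : su2_sphere r M -> \det M = (r ^+ 2)%:C.
Proof.
move=> /su2_sphereP[x [a [b [-> <-]]]]; rewrite su2_mxE det_mx2; simpc.
by congr Complex; ring.
Qed.

(** A description of the sphere in which every condition is visibly invariant
    under conjugation by a unitary matrix. The trace condition excludes the
    scalar matrices [i r] and [- i r]. *)
Lemma su2_sphere_charac r M : su2_sphere r M <->
  [/\ M ^t* = - M, \tr M = 0 & M * M = (- r ^+ 2)%:C *: 1].
Proof.
split=> [Mr|[]].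
  split; [exact: su2_sphere_adj Mr|exact: su2_sphere_tr Mr|].
  exact: su2_sphere_sqr Mr.
rewrite [M]mx2_eta; move: (M 0 0) (M 0 1) (M 1 0) (M 1 1).
move=> [a a'] [b b'] [c c'] [d d'].
rewrite mxtrace_mx2 mx2M mx2_scalar mx2N /= => adjE trE sqE.
have /= := congr1 (fun A : 'M[R[i]]_2 => A 0 0) adjE.
rewrite !mxE /= => -[a0].
have /= := congr1 (fun A : 'M[R[i]]_2 => A 1 0) adjE.
rewrite !mxE /= => -[cE c'E].
move: trE => [dE d'E].
have /= := congr1 (fun A : 'M[R[i]]_2 => A 0 0) sqE.
rewrite !mxE /= => -[E _].
apply/su2_sphereP; exists a', b, b'; split.
  rewrite su2_mxE; apply: mx2_congr => //; congr Complex; lra.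
nra.
Qed.

Lemma SU2_inv g : SU2 g -> g^-1 = g ^t*.
Proof. by move=> [gu _]; exact: invmx_unitary. Qed.

Lemma is_unit_subgroup_SU2 : is_unit_subgroup (@SU2 R).
Proof.
split=> [g [gu _]||g k [gu dg] [ku dk]|g [gu dg]].
- exact: unitarymx_unit.
- split; last exact: det1.
  by apply/unitarymxP; rewrite trmx1 map_mx1 mulmx1.
- by split; [exact: mul_unitarymx|rewrite det_mulmx dg dk mulr1].
- split; last by rewrite [LHS]det_inv dg invr1.
  by rewrite SU2_inv// trmxC_unitary.
Qed.

Lemma su2_sphere_conj_act r M g : su2_sphere r M -> SU2 g ->
  su2_sphere r (conj_act M g).
Proof.
move=> /su2_sphere_charac[adjM trM sqM] Gg.
have Ug := unit_subgroup_unit is_unit_subgroup_SU2 Gg.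
apply/su2_sphere_charac; rewrite /conj_act; split.
- rewrite SU2_inv// -!mulmxE !trmx_mul !map_mxM /= trmxCK adjM.
  by rewrite mulNmx mulmxN mulmxA.
- by rewrite -!mulmxE mxtrace_mulC !mulmxE mulrA divrr// mul1r.
- rewrite !mulrA -[_ * g * g^-1]mulrA divrr// mulr1 -[_ * M * M]mulrA sqM.
  by rewrite -scalerAr -scalerAl mulr1 mulVr.
Qed.

(** Here [cos (pi / 2) = 0] and [sin (pi / 2) = 1]. *)
Lemma expmx_su2_sphere M : su2_sphere (pi / 2) M ->
  expmx M = ((pi / 2)^-1)%:C *: M.
Proof.
move=> /su2_sphere_sqr /(expmx_sqr_scalar (pihalf_neq0 R)) ->.
by rewrite cos_pihalf sin_pihalf scale0r add0r mul1r.
Qed.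

Lemma adjmx_realZ x M : (x%:C *: M) ^t* = x%:C *: M ^t*.
Proof.
rewrite linearZ /= map_mxZ; congr (_ *: _).
by rewrite -[LHS]/(x +i* (- 0)) oppr0.
Qed.

Lemma SU2_expmx M : su2_sphere (pi / 2) M -> SU2 (expmx M).
Proof.
have r0 := pihalf_neq0 R.
move=> Mr; rewrite expmx_su2_sphere//; split.
  apply/unitarymxP.
  rewrite adjmx_realZ (su2_sphere_adj Mr) scalerN.
  rewrite mulmxN -scalemxAl -scalemxAr [M *m M](su2_sphere_sqr Mr) !scalerA.
  rewrite -!rmorphM -scaleNr -rmorphN /=.
  by rewrite mulrN opprK -expr2 -exprMn mulVf// expr1n scale1r.
rewrite detZ (su2_sphere_det Mr) -rmorphXn -rmorphM /= -exprMn mulVf//.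
by rewrite expr1n.
Qed.

Lemma is_augmented_quandle_su2_sphere :
  is_augmented_quandle (su2_sphere (pi / 2 : R)) (@SU2 R)
    (@conj_act R) (@expmx R[i] 1).
Proof.
have Gu := unit_subgroup_unit is_unit_subgroup_SU2.
split.
- exact: is_unit_subgroup_SU2.
- exact: su2_sphere_conj_act.
- by move=> M _; rewrite /conj_act invr1 mul1r mulr1.
- by move=> M g k _ /Gu Ug /Gu Uk; rewrite /conj_act invrM// !mulrA.
- exact: SU2_expmx.
- move=> M g Mr Gg.
  rewrite !expmx_su2_sphere//; last exact: su2_sphere_conj_act.
  by rewrite /conj_act scalerAl scalerAr.
- move=> M Mr; rewrite /conj_act -mulrA.
  suff -> : M * expmx M = expmx M * M by rewrite mulKr//; apply/Gu/SU2_expmx.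
  by rewrite expmx_su2_sphere// -scalerAr -scalerAl.
Qed.

End su2.

(** * The isomorphism *)

Section sphere_to_su2.
Variable R : realType.
Implicit Types x y : 'rV[R]_3.

(** The pure quaternion [x1 i + x2 j + x3 k], as a matrix of su(2); the three
    coordinates of [x] have indices 0, 1, 2. *)
Definition pure_quaternion x : 'M[R[i]]_2 :=
  su2_mx (x 0 (inord 0)) (x 0 (inord 1) +i* x 0 (inord 2)).

Lemma dot3E x y : dot x y = x 0 (inord 0) * y 0 (inord 0)
  + x 0 (inord 1) * y 0 (inord 1) + x 0 (inord 2) * y 0 (inord 2).
Proof.
rewrite /dot !big_ord_recl big_ord0 addr0 addrA.
by congr (x 0 _ * y 0 _ + x 0 _ * y 0 _ + x 0 _ * y 0 _);
  apply: val_inj; rewrite /= inordK.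
Qed.

Lemma pure_quaternionZB a x y :
  pure_quaternion (a *: x - y) = a%:C *: pure_quaternion x - pure_quaternion y.
Proof.
rewrite /pure_quaternion !su2_mxE mx2Z mx2N mx2D !mxE.
by apply: mx2_congr; simpc; congr Complex; ring.
Qed.

Lemma pure_quaternionZ a x :
  pure_quaternion (a *: x) = a%:C *: pure_quaternion x.
Proof.
rewrite /pure_quaternion !su2_mxE mx2Z !mxE.
by apply: mx2_congr; simpc; congr Complex; ring.
Qed.

Lemma sphere_to_su2E x : sphere_to_su2 x = (pi / 2)%:C *: pure_quaternion x.
Proof.
congr (_ *: _); rewrite /pure_quaternion su2_mxE -[Num.imaginary]/(0 +i* 1).
by apply: mx2_congr; rewrite -?complexr0; simpc; congr Complex.
Qed.

(** The Clifford relation between pure quaternions. *)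
Lemma pure_quaternion_anticomm x y :
  pure_quaternion x * pure_quaternion y
    + pure_quaternion y * pure_quaternion x = (- (2 * dot x y))%:C *: 1.
Proof. by rewrite su2_mx_anticomm /= -dot3E. Qed.

Lemma pure_quaternion_sphere r x :
  dot x x = r ^+ 2 -> su2_sphere r (pure_quaternion x).
Proof.
move=> xx; apply/su2_sphereP; do 3?eexists; split; first by [].
by rewrite -xx dot3E !expr2.
Qed.

Lemma su2_sphere_pure_quaternion r M :
  su2_sphere r M -> exists2 x, dot x x = r ^+ 2 & M = pure_quaternion x.
Proof.
move=> /su2_sphereP[a [b [c [-> E]]]].
exists (\row_i [:: a; b; c]`_i).
  by rewrite dot3E !mxE !inordK//= -!expr2.
by rewrite /pure_quaternion !mxE !inordK.
Qed.

Lemma pure_quaternion_inj : injective pure_quaternion.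
Proof.
move=> x y; rewrite /pure_quaternion !su2_mxE => E.
have := congr1 (fun A : 'M[R[i]]_2 => A 0 0) E; rewrite !mxE /= => -[E0].
have := congr1 (fun A : 'M[R[i]]_2 => A 0 1) E; rewrite !mxE /= => -[E1 E2].
apply/rowP => i; rewrite -(inord_val i).
by case: i => -[|[|[|//]]].
Qed.

Lemma sphere_to_su2_bij :
  set_bij (@sphere2 R) (su2_sphere (pi / 2 : R)) (@sphere_to_su2 R).
Proof.
split.
- move=> x xx; rewrite /= sphere_to_su2E -pure_quaternionZ.
  apply: pure_quaternion_sphere.
  by rewrite dotZl dotZr xx mulr1 expr2.
- move=> x y _ _; rewrite !sphere_to_su2E -!pure_quaternionZ.
  by move=> /pure_quaternion_inj /(scalerI (pihalf_neq0 R)).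
- move=> M /su2_sphere_pure_quaternion[x xE ->]; exists ((pi / 2)^-1 *: x).
    rewrite /sphere2 /= dotZl dotZr xE mulrA -expr2 -exprMn.
    by rewrite mulVf ?pihalf_neq0// expr1n.
  rewrite sphere_to_su2E -pure_quaternionZ scalerA mulfV ?scale1r//.
  exact: pihalf_neq0.
Qed.

Lemma sphere_to_su2_hom x y : sphere2 x -> sphere2 y ->
  sphere_to_su2 (spherical_op x y) =
  augmented_op (@conj_act R) (@expmx R[i] 1)
    (sphere_to_su2 x) (sphere_to_su2 y).
Proof.
move=> xx yy; have Yr : su2_sphere (pi / 2) (sphere_to_su2 y).
  by have [+ _ _] := sphere_to_su2_bij; apply.
have eY : expmx (sphere_to_su2 y) = pure_quaternion y.
  rewrite expmx_su2_sphere// sphere_to_su2E scalerA -rmorphM /=.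
  by rewrite mulVf ?pihalf_neq0// scale1r.
have Uy : pure_quaternion y \is a GRing.unit.
  rewrite -eY; apply: (unit_subgroup_unit (is_unit_subgroup_SU2 R)).
  exact: SU2_expmx.
(* Write [H] for [pure_quaternion]. Multiplied by [H y] on the left, and up to
   the factor [pi / 2], the claim reads
   [H y (2 <x, y> H y - H x) = H x H y]. *)
rewrite /augmented_op /conj_act eY -mulrA; apply: (mulrI Uy).
rewrite mulVKr// !sphere_to_su2E pure_quaternionZB -!scalerAl -!scalerAr.
congr (_ *: _).
have yy1 : pure_quaternion y * pure_quaternion y = (-1)%:C *: 1.
  rewrite (su2_sphere_sqr (r := 1)) ?expr1n//.
  by apply: pure_quaternion_sphere; rewrite expr1n.
have -> : pure_quaternion x * pure_quaternion y =
    (- (2 * dot x y))%:C *: 1 - pure_quaternion y * pure_quaternion x.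
  by rewrite -pure_quaternion_anticomm addrK.
by rewrite mulrBr -scalerAr yy1 scalerA -rmorphM /= mulrN1.
Qed.

End sphere_to_su2.

Theorem theorem3p11 (R : realType) :
  is_augmented_quandle (su2_sphere (pi / 2 : R)) (@SU2 R)
    (@conj_act R) (@expmx R[i] 1)
  /\ is_quandle_isomorphism
       (@sphere2 R) (@spherical_op R)
       (su2_sphere (pi / 2 : R)) (augmented_op (@conj_act R) (@expmx R[i] 1))
       (@sphere_to_su2 R).
Proof.
have aug := is_augmented_quandle_su2_sphere R.
split; first exact: aug.
split.
- exact: is_quandle_sphere2.
- exact: is_quandle_augmented aug.
- exact: sphere_to_su2_bij.
- exact: sphere_to_su2_hom.
Qed.
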